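(* Let $n,m\ge 1$ be integers. Then $P(n,m)$ implies $P'(n,m)$. Explicitly: suppose that for all symmetric $n\times n$ matrices $A_1,\dots,A_m$ one has \[ \left(\sum_{r=1}^m\|A_r\|^2\right)^2\ \ge\ 2\sum_{1\le r<s\le m}\|[A_r,A_s]\|^2 . \] Then for all symmetric $n\times n$ matrices $A_1,\dots,A_m$ one has \[ 2\sum_{1\le i<j\le m}\|[A_i,A_j]\|^2\ \le\ \frac32\left(\sum_{i=1}^m\|A_i\|^2\right)^2-\sum_{i=1}^m\|A_i\|^4 . \]
   Context: All matrices have real entries. $\|A\|$ denotes the Frobenius norm, $\|A\|^2=\operatorname{tr}(AA^T)=\sum_{i,j}a_{ij}^2$, and $[A,B]=AB-BA$. $P(n,m)$ (the DDVV inequality) is the assertion that the first displayed inequality holds for all symmetric $n\times n$ matrices $A_1,\dots,A_m$; $P'(n,m)$ is the assertion that the second displayed inequality holds for all symmetric $n\times n$ matrices $A_1,\dots,A_m$. *)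

(* Defs.v *)
From mathcomp Require Import all_boot all_order all_algebra.
From mathcomp Require Import reals.

Set Implicit Arguments.
Unset Strict Implicit.
Unset Printing Implicit Defensive.

Import Order.TTheory GRing.Theory Num.Theory.

Local Open Scope ring_scope.

(* Not the norm `|A| that MathComp-Analysis puts on matrices, which is the
   maximum of the absolute values of the entries. *)
Definition frobenius (R : realType) (n : nat) (A : 'M[R]_n) : R :=
  Num.sqrt (\tr (A *m A^T)).

Definition mx_commutator (R : realType) (n : nat) (A B : 'M[R]_n) : 'M[R]_n :=
  A *m B - B *m A.

Definition DDVV (R : realType) (n m : nat) : Prop :=
  forall A : 'I_m -> 'M[R]_n,
    (forall r, A r \is symmetricmx) ->
    (\sum_(r < m) frobenius (A r) ^+ 2) ^+ 2 >=
      2 * \sum_(r < m) \sum_(s < m | (r < s)%N)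
            frobenius (mx_commutator (A r) (A s)) ^+ 2.

Definition DDVV' (R : realType) (n m : nat) : Prop :=
  forall A : 'I_m -> 'M[R]_n,
    (forall i, A i \is symmetricmx) ->
    2 * \sum_(i < m) \sum_(j < m | (i < j)%N)
          frobenius (mx_commutator (A i) (A j)) ^+ 2 <=
      3 / 2 * (\sum_(i < m) frobenius (A i) ^+ 2) ^+ 2
        - \sum_(i < m) frobenius (A i) ^+ 4.

(* Main.v *)
(* By homogeneity, DDVV applied to the rescaled matrices [sqrt (t i) *: A i]
   gives, for all weights [t i >= 0],
   [\sum_(i, j) t i * t j * c i j <= (\sum_i t i * x i) ^+ 2], where [x i] and
   [c i j] are the squared norms of [A i] and of [[A i, A j]].
   If every [x i] is at most half of the total [T], then
   [\sum_i x i ^+ 2 <= T ^+ 2 / 2] and unit weights suffice.  Otherwise a single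
   [a = x k] exceeds the sum [b] of the others; weighting [k] by [b / a] and the
   others by 1 gives [\sum_(i, j) c i j <= 4 * a * b], which is enough because
   [4 * a * b <= (a + b) ^+ 2]. *)
Require Import Defs.
From mathcomp Require Import all_boot all_order all_algebra.
From mathcomp Require Import reals.
From mathcomp Require Import ring lra.

Set Implicit Arguments.
Unset Strict Implicit.
Unset Printing Implicit Defensive.

Import Order.TTheory GRing.Theory Num.Theory.

Local Open Scope ring_scope.

(** Serves twice: with [b] half of the total when no term dominates, and with [b] the sum of the
    non-dominant terms. *)
Lemma sum_sqr_le_max (R : realFieldType) (I : finType) (P : pred I)
    (x : I -> R) (b : R) :
  (forall i, P i -> 0 <= x i) -> (forall i, P i -> x i <= b) ->
  \sum_(i | P i) x i ^+ 2 <= b * \sum_(i | P i) x i.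
Proof.
move=> x0 xb; rewrite mulr_sumr; apply: ler_sum => i Pi.
by rewrite expr2 ler_wpM2r ?x0 ?xb.
Qed.

(** For [b > 0], the weight [s = b / a] gives [2 * s * l + q <= 4 * b ^+ 2], hence [l <= 2 * a * b]
    because [q >= 0]. As [s <= 1], adding [2 * (1 - s)] times the second bound to the first yields
    the claim. *)
Lemma linear_bound_of_weights (R : realFieldType) (a b l q : R) :
  0 < a -> 0 <= b <= a -> 0 <= l -> 0 <= q ->
  (forall t, 0 <= t -> 2 * t * l + q <= (t * a + b) ^+ 2) ->
  2 * l + q <= 4 * a * b.
Proof.
move=> a0 /andP[b0 ba] l0 q0 H.
have an0 : a != 0 by rewrite gt_eqF.
have [bE|bn0] := eqVneq b 0.
  have H0 := H 0 (lexx 0).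
  (* With [b = 0] the left side is linear in [t] and the right side quadratic, so a small [t] forces
     [l = 0]; this one minimises [(t * a) ^+ 2 - 2 * t * l]. The choice [t = 0] has already given
     [q <= 0]. *)
  have := H (l / a ^+ 2) (divr_ge0 l0 (sqr_ge0 a)).
  rewrite bE addr0.
  have -> : (l / a ^+ 2 * a) ^+ 2 = (l / a) ^+ 2 by field.
  have -> : 2 * (l / a ^+ 2) * l = 2 * (l / a) ^+ 2 by field.
  move=> H1; have : (l / a) ^+ 2 <= 0 by lra.
  rewrite real_exprn_even_le0 ?num_real //= mulf_eq0 invr_eq0 (negPf an0) orbF.
  by move=> /eqP l00; move: H0; rewrite bE l00 !(mul0r, mulr0, add0r, addr0) expr0n.
have bp : 0 < b by rewrite lt_neqAle eq_sym bn0.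
have := H (b / a) (divr_ge0 b0 (ltW a0)).
have -> : (b / a * a + b) ^+ 2 = 4 * b ^+ 2 by field.
set s := b / a => H1.
have bE : b = s * a by rewrite /s divfK.
have s0 : 0 < s by rewrite divr_gt0.
have s1 : s <= 1 by rewrite ler_pdivrMr ?mul1r.
(* Everything is expressed through [s] and [a]; this bound is [2 * a * b]. *)
have lle : l <= 2 * s * a ^+ 2.
  by rewrite -(ler_pM2l s0); move: H1; rewrite bE; lra.
have : (1 - s) * l <= (1 - s) * (2 * s * a ^+ 2) by rewrite ler_wpM2l ?subr_ge0.
by move: H1; rewrite bE; lra.
Qed.

Lemma sum_sym_pairs (R : pzSemiRingType) (m : nat) (c : 'I_m -> 'I_m -> R) :
  (forall i j, c i j = c j i) -> (forall i, c i i = 0) ->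
  \sum_i \sum_j c i j = 2 * \sum_(i < m) \sum_(j < m | (i < j)%N) c i j.
Proof.
move=> cC c0.
have -> : \sum_i \sum_j c i j =
    \sum_(i < m) \sum_(j < m | (i < j)%N) c i j +
    \sum_(i < m) \sum_(j < m | (j < i)%N) c i j.
  rewrite -big_split; apply: eq_bigr => i _ /=.
  rewrite (bigD1 i) //= c0 add0r (bigID (fun j : 'I_m => (i < j)%N)) /=.
  by congr (_ + _); apply: eq_bigl => j; rewrite -val_eqE /=; case: ltngtP.
rewrite [X in _ + X](exchange_big_dep predT) //= mulr_natl mulr2n.
by congr (_ + _); apply: eq_bigr => i _; apply: eq_bigr => j _; rewrite cC.
Qed.

Lemma sum_pairs_split (R : pzRingType) (I : finType) (k : I) (c : I -> I -> R) :
  \sum_i \sum_j c i j = c k k + \sum_(j | j != k) c k j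
    + \sum_(i | i != k) c i k + \sum_(i | i != k) \sum_(j | j != k) c i j.
Proof.
rewrite (bigD1 k) //= (bigD1 k) //= -[RHS]addrA; congr (_ + _).
by rewrite -big_split; apply: eq_bigr => i _; rewrite (bigD1 k).
Qed.

Lemma weighted_pair_bound (R : realFieldType) (I : finType)
    (x : I -> R) (c : I -> I -> R) :
  (forall i, 0 <= x i) -> (forall i j, 0 <= c i j) ->
  (forall i j, c i j = c j i) -> (forall i, c i i = 0) ->
  (forall t : I -> R, (forall i, 0 <= t i) ->
     \sum_i \sum_j t i * t j * c i j <= (\sum_i t i * x i) ^+ 2) ->
  \sum_i \sum_j c i j <= 3 / 2 * (\sum_i x i) ^+ 2 - \sum_i x i ^+ 2.
Proof.
move=> x0 c0 cC cd H.
have [/existsP[k kmax]|/existsPn small] :=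
  boolP [exists k, \sum_i x i < 2 * x k]; last first.
  have := H (fun=> 1) (fun=> ler01).
  under eq_bigr do under eq_bigr do rewrite !mul1r.
  under [X in _ <= X ^+ 2]eq_bigr do rewrite mul1r.
  (* No term exceeds half of the total, so the squares sum to at most half of its square, and
     [3 / 2 - 1 / 2 = 1] is the constant that unit weights give. *)
  have := @sum_sqr_le_max R I predT x (\sum_i x i / 2) (fun i _ => x0 i).
  move=> /(_ _)/wrap[i _|]; last by rewrite -mulr_suml; lra.
  by rewrite -mulr_suml; have := small i; rewrite -leNgt; lra.
set a := x k in kmax; pose b := \sum_(i | i != k) x i.
have xE : \sum_i x i = a + b by rewrite (bigD1 k).
have b0 : 0 <= b by apply: sumr_ge0.
pose l := \sum_(j | j != k) c k j.
pose q := \sum_(i | i != k) \sum_(j | j != k) c i j.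
have lE : \sum_(i | i != k) c i k = l by apply: eq_bigr => i _; rewrite cC.
have cE : \sum_i \sum_j c i j = 2 * l + q.
  by rewrite (sum_pairs_split k) cd lE -/l -/q; ring.
have sqE : \sum_i x i ^+ 2 <= a ^+ 2 + b ^+ 2.
  rewrite (bigD1 k) //= lerD2l [leRHS]expr2; apply: sum_sqr_le_max => // i ik.
  by rewrite /b (bigD1 i) //= lerDl sumr_ge0.
have : 2 * l + q <= 4 * a * b.
  apply: linear_bound_of_weights; try lra.
  - by apply: sumr_ge0.
  - by apply: sumr_ge0 => i _; apply: sumr_ge0.
  (* The row and the column of [k] each contribute [t * l]; the [t ^+ 2] term vanishes with
     [c k k]. *)
  move=> t t0; pose w i := if i == k then t else 1.
  have := H w; rewrite (sum_pairs_split k) [\sum_i w i * x i](bigD1 k) //=.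
  rewrite cd mulr0 add0r /w eqxx.
  under eq_bigr => j /negPf -> do rewrite mulr1.
  under [X in _ + X + _]eq_bigr => j /negPf -> do rewrite mul1r.
  under [X in _ + X]eq_bigr => i /negPf ->
    do under eq_bigr => j /negPf -> do rewrite !mul1r.
  under [X in _ <= (_ + X) ^+ 2]eq_bigr => j /negPf -> do rewrite mul1r.
  rewrite -!mulr_sumr lE -/l -/q -/a -/b => /(_ _)/wrap[i|]; last by lra.
  by case: ifP.
(* [3 / 2 * (a + b) ^+ 2 - a ^+ 2 - b ^+ 2] equals [4 * a * b + (a - b) ^+ 2 / 2]. *)
have := sqr_ge0 (a - b).
by rewrite cE xE; lra.
Qed.

Lemma frobenius_sqr (R : realType) (n : nat) (A : 'M[R]_n) :
  frobenius A ^+ 2 = \tr (A *m A^T).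
Proof.
rewrite sqr_sqrtr //; apply: sumr_ge0 => i _; rewrite mxE.
by apply: sumr_ge0 => j _; rewrite !mxE -expr2 sqr_ge0.
Qed.

Lemma frobenius_sqrZ (R : realType) (n : nat) (s : R) (A : 'M[R]_n) :
  frobenius (s *: A) ^+ 2 = s ^+ 2 * frobenius A ^+ 2.
Proof.
by rewrite !frobenius_sqr linearZ /= -scalemxAl -scalemxAr scalerA mxtraceZ.
Qed.

Lemma mx_commutatorZ (R : realType) (n : nat) (s t : R) (A B : 'M[R]_n) :
  mx_commutator (s *: A) (t *: B) = (s * t) *: mx_commutator A B.
Proof.
rewrite /mx_commutator scalerBr -!scalemxAl -!scalemxAr !scalerA.
by rewrite [t * s]mulrC.
Qed.

(** The sign is written as a scalar multiple so that [frobenius_sqrZ] applies to it. *)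
Lemma mx_commutatorC (R : realType) (n : nat) (A B : 'M[R]_n) :
  mx_commutator A B = (-1) *: mx_commutator B A.
Proof. by rewrite /mx_commutator scaleN1r opprB. Qed.

Lemma frobenius_commutatorC (R : realType) (n : nat) (A B : 'M[R]_n) :
  frobenius (mx_commutator A B) ^+ 2 = frobenius (mx_commutator B A) ^+ 2.
Proof. by rewrite mx_commutatorC frobenius_sqrZ sqrrN expr1n mul1r. Qed.

Lemma frobenius_commutatorxx (R : realType) (n : nat) (A : 'M[R]_n) :
  frobenius (mx_commutator A A) ^+ 2 = 0.
Proof. by rewrite /mx_commutator subrr frobenius_sqr mul0mx mxtrace0. Qed.

(** The commutator is bilinear, so scaling each [A i] by the square root of [t i] multiplies its
    squared norm by [t i] and that of the commutator by [t i * t j]. *)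
Lemma DDVV_weighted (R : realType) (n m : nat) (A : 'I_m -> 'M[R]_n)
    (t : 'I_m -> R) :
  DDVV R n m -> (forall i, A i \is symmetricmx) -> (forall i, 0 <= t i) ->
  \sum_i \sum_j t i * t j * frobenius (mx_commutator (A i) (A j)) ^+ 2 <=
    (\sum_i t i * frobenius (A i) ^+ 2) ^+ 2.
Proof.
move=> H symA t0; rewrite sum_sym_pairs; first last.
- by move=> i; rewrite frobenius_commutatorxx mulr0.
- by move=> i j; rewrite frobenius_commutatorC [t i * _]mulrC.
have := H (fun i => Num.sqrt (t i) *: A i) => /(_ _)/wrap[i|].
  (* [symmetricmx] is the Hermitian predicate with trivial sign and identity conjugation; both are
     simplified away to leave [A i] equal to its transpose. *)
  have /is_hermitianmxP := symA i; rewrite expr0 scale1r map_mx_id // => AE.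
  by apply/is_hermitianmxP; rewrite expr0 scale1r map_mx_id // linearZ /= -AE.
under [X in _ <= X ^+ 2]eq_bigr do rewrite frobenius_sqrZ sqr_sqrtr //.
under [X in _ * X <= _]eq_bigr => i _ do under eq_bigr => j _ do
  rewrite mx_commutatorZ frobenius_sqrZ exprMn !(sqr_sqrtr (t0 _)).
by [].
Qed.

Theorem theorem4p3 (R : realType) (n m : nat) (hn : (1 <= n)%N) (hm : (1 <= m)%N) :
  DDVV R n m -> DDVV' R n m.
Proof.
move=> H A symA; rewrite -sum_sym_pairs; first last.
- by move=> i; apply: frobenius_commutatorxx.
- by move=> i j; apply: frobenius_commutatorC.
(* Fourth powers become squares of the squared norms, which play the part of [x i]. *)
under [X in _ - X]eq_bigr do rewrite (exprM _ 2 2).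
apply: weighted_pair_bound => [i|i j|i j|i|t t0].
- exact: sqr_ge0.
- exact: sqr_ge0.
- exact: frobenius_commutatorC.
- exact: frobenius_commutatorxx.
- exact: DDVV_weighted.
Qed.
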